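(* For even positive integers $n$, $$\sum_{w\in\mathfrak{D}_n^+}t^{\mathrm{odes}_D(w)}s^{\mathrm{edes}_D(w)}q^{\mathrm{inv}_D(w)}=\sum_{r=0}^{\frac n2-1}q^{\binom{2r+1}{2}}\binom{n}{2r+1}_qD_{n-2r-1}(s,t,q)(s-1)^r(t-1)^r+\sum_{r=1}^{\frac n2}q^{\binom{2r}{2}}\binom{n}{2r}_qD_{n-2r}(s,t,q)(s-1)^{r-1}(t-1)^r.$$ For odd positive integers $n$, $$\sum_{w\in\mathfrak{D}_n^+}t^{\mathrm{odes}_D(w)}s^{\mathrm{edes}_D(w)}q^{\mathrm{inv}_D(w)}=\sum_{r=0}^{\lfloor n/2\rfloor}q^{\binom{2r+1}{2}}\binom{n}{2r+1}_qD_{n-2r-1}(s,t,q)(s-1)^r(t-1)^r+\sum_{r=1}^{\lfloor n/2\rfloor}q^{\binom{2r}{2}}\binom{n}{2r}_qD_{n-2r}(s,t,q)(s-1)^{r}(t-1)^{r-1}.$$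
   Context: $\mathfrak{B}_n$ is the group of permutations $w$ of $\{\pm1,\dots,\pm n\}$ with $w(-i)=-w(i)$, written $w=w_1,\dots,w_n$ with $w_i=w(i)$; $\mathfrak{D}_n\subseteq\mathfrak{B}_n$ is the subgroup of those $w$ with an even number of negative entries among $w_1,\dots,w_n$, and $\mathfrak{D}_n^+=\{w\in\mathfrak{D}_n:w_n>0\}$. For $w\in\mathfrak{D}_n$ ($n\ge2$) set $w_{-1}=-w_1$; an index $i\in\{-1,1,2,\dots,n-1\}$ is a descent if $w_i>w_{|i|+1}$ (so $-1$ is a descent iff $-w_1>w_2$). $\mathrm{odes}_D(w)$ (resp. $\mathrm{edes}_D(w)$) is the number of odd (resp. even) descents; the index $-1$ is odd. For $n\le 1$ there are no descents. $\mathrm{inv}_D(w)=|\{1\le i<j\le n:w_i>w_j\}|+|\{1\le i<j\le n:-w_i>w_j\}|$. $D_n(s,t,q)=\sum_{w\in\mathfrak{D}_n}s^{\mathrm{edes}_D(w)}t^{\mathrm{odes}_D(w)}q^{\mathrm{inv}_D(w)}$, with $D_0(s,t,q)=D_1(s,t,q)=1$. $\binom{n}{k}_q$ is the Gaussian binomial coefficient. *)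

(* Defs.v *)
From HB Require Import structures.
From mathcomp Require Import all_boot all_order all_fingroup all_algebra.
From mathcomp Require Import ring.

Set Implicit Arguments.
Unset Strict Implicit.
Unset Printing Implicit Defensive.

Import Order.TTheory GRing.Theory Num.Theory.
Local Open Scope ring_scope.

(* The finite set {1, -1, ..., n, -n}: (i, b) stands for (-1)^b (i + 1). *)
Definition letter (n : nat) : finType := ('I_n * bool)%type.

Definition letter_val (n : nat) (x : letter n) : int := (-1) ^+ x.2 * x.1.+1%:Z.

Definition letter_opp (n : nat) (x : letter n) : letter n := (x.1, ~~ x.2).

Definition Bgroup (n : nat) : {set {perm letter n}} :=
  [set w : {perm letter n} | [forall x, w (letter_opp x) == letter_opp (w x)]].

(* w(i) as an integer, for 1 <= |i| <= n; indices with |i| > n give 0, and the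
   index 0 (an alias of 1) is never used.  For w in Bgroup n, entry w (-1) is
   - entry w 1 (entryN), which is the convention for w_{-1}. *)
Definition entry (n : nat) (w : {perm letter n}) (i : int) : int :=
  if insub `|i|%N.-1 is Some k then letter_val (w (k, i < 0)) else 0.

Lemma entryN (n : nat) (w : {perm letter n}) (i : int) :
  w \in Bgroup n -> i != 0 -> entry w (- i) = - entry w i.
Proof.
rewrite inE => /forallP oppw i_neq0; rewrite /entry abszN.
case: insubP => [k _ _|_]; last by rewrite oppr0.
have -> : (- i < 0) = ~~ (i < 0)
  by rewrite oppr_lt0 -leNgt le_eqVlt eq_sym (negPf i_neq0).
rewrite -[(k, ~~ _)]/(letter_opp (k, i < 0)) (eqP (oppw _)) /letter_val /=.
by case: (w _).2; rewrite /= ?expr1 ?expr0 ?mulN1r ?mul1r ?opprK.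
Qed.

Definition Dgroup (n : nat) : {set {perm letter n}} :=
  [set w in Bgroup n | ~~ odd #|[set i : 'I_n | entry w i.+1%:Z < 0]|].

Definition Dplus (n : nat) : {set {perm letter n}} :=
  [set w in Dgroup n | 0 < entry w n%:Z].

(* [:: -1; 1; ...; n - 1], and no index at all when n <= 1. *)
Definition desD_indices (n : nat) : seq int :=
  if (1 < n)%N then -1 :: [seq i%:Z | i <- iota 1 n.-1] else [::].

Definition is_desD (n : nat) (w : {perm letter n}) (i : int) : bool :=
  entry w (`|i|%N.+1)%:Z < entry w i.

Definition odesD (n : nat) (w : {perm letter n}) : nat :=
  count (fun i : int => is_desD w i && odd `|i|%N) (desD_indices n).

Definition edesD (n : nat) (w : {perm letter n}) : nat :=
  count (fun i : int => is_desD w i && ~~ odd `|i|%N) (desD_indices n).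

Definition invD (n : nat) (w : {perm letter n}) : nat :=
  (#|[set p : 'I_n * 'I_n | (p.1 < p.2)%N &&
       (entry w p.2.+1%:Z < entry w p.1.+1%:Z)%R]| +
   #|[set p : 'I_n * 'I_n | (p.1 < p.2)%N &&
       (entry w p.2.+1%:Z < - entry w p.1.+1%:Z)%R]|)%N.

(* Polynomials in the commuting variables s, t, q are represented by their
   values at arbitrary elements of arbitrary commutative rings; the choice
   of ring Z[s,t,q] and of its variables recovers the polynomials. *)
Definition Dpoly (R : comNzRingType) (n : nat) (s t q : R) : R :=
  \sum_(w in Dgroup n) s ^+ edesD w * t ^+ odesD w * q ^+ invD w.

Definition qfact (n : nat) : {poly int} :=
  \prod_(1 <= i < n.+1) \sum_(0 <= j < i) 'X^j.

(* [n]_q! / ([k]_q! [n-k]_q!).  The divisor is monic, so %/ is Euclidean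
   division in Z[q], and the division is exact (qbinom_fact). *)
Definition qbinom (n k : nat) : {poly int} :=
  if (k <= n)%N then qfact n %/ (qfact k * qfact (n - k)) else 0.

Definition qbinom_at (R : comNzRingType) (n k : nat) (q : R) : R :=
  (map_poly (fun z : int => z%:~R : R) (qbinom n k)).[q].

Lemma qnumD (a b : nat) :
  \sum_(0 <= j < a + b) 'X^j =
  \sum_(0 <= j < a) 'X^j + 'X^a * \sum_(0 <= j < b) 'X^j :> {poly int}.
Proof.
rewrite (big_cat_nat (leq0n a) (leq_addr b a)) /=; congr (_ + _).
rewrite -[X in \sum_(X <= _ < _) _]add0n big_addn addKn big_distrr /=.
by apply: eq_bigr => j _; rewrite addnC exprD.
Qed.

Lemma qfactS (n : nat) : qfact n.+1 = qfact n * \sum_(0 <= j < n.+1) 'X^j.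
Proof. by rewrite /qfact big_nat_recr. Qed.

Lemma qfact0 : qfact 0 = 1.
Proof. by rewrite /qfact big_nil. Qed.

Lemma monic_qfact (n : nat) : qfact n \is monic.
Proof.
rewrite /qfact big_nat_cond; apply: monic_prod => i /andP[/andP[i_gt0 _] _].
case: i i_gt0 => // i _; rewrite big_mkord.
rewrite (_ : \sum_(j < i.+1) 'X^j = \poly_(j < i.+1) 1); last first.
  by rewrite poly_def; apply: eq_bigr => j _; rewrite scale1r.
by rewrite monicE lead_coef_poly ?oner_eq0.
Qed.

Lemma qfact_dvd (a b : nat) :
  exists g : {poly int}, qfact (a + b) = g * (qfact a * qfact b).
Proof.
elim: a b => [|a IHa] b; first by exists 1; rewrite qfact0 !mul1r.
elim: b => [|b [g Eg]]; first by exists 1; rewrite qfact0 addn0 mulr1 mul1r.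
have [h Eh] := IHa b.+1.
exists (h + 'X^(a.+1) * g).
rewrite addnS qfactS -addnS qnumD mulrDr [qfact a.+1]qfactS.
rewrite {1}addSnnS Eh addSn -addSn Eg [qfact b.+1]qfactS [qfact a.+1]qfactS.
by ring.
Qed.

Lemma qbinom_fact (n k : nat) : (k <= n)%N ->
  qbinom n k * (qfact k * qfact (n - k)) = qfact n.
Proof.
move=> le_kn; rewrite /qbinom le_kn.
have [g] := qfact_dvd k (n - k); rewrite subnKC // => ->.
by rewrite Pdiv.IdomainMonic.mulpK // rpredM ?monic_qfact.
Qed.

Lemma Dgroup_le1 (n : nat) : (n <= 1)%N -> Dgroup n = [set 1%g].
Proof.
move=> le_n1; have ord_eq (i j : 'I_n) : i = j.
  by apply: val_inj; case: n le_n1 i j => [|[|//]] _ [[|i] hi] [[|j] hj].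
have entryE (w : {perm letter n}) (i : 'I_n) :
    (entry w i.+1%:Z < 0) = (w (i, false)).2.
  rewrite /entry /= insubT ?ltn_ord // => lt_in.
  rewrite (_ : Sub _ _ = i); last by apply: val_inj.
  by rewrite /letter_val; case: (w _).2; rewrite ?expr1 ?expr0 ?mulN1r ?mul1r.
apply/setP=> w; rewrite !inE; apply/andP/eqP => [[/forallP oppw evw] | ->].
  apply/permP=> -[i b]; rewrite perm1.
  have w0 : w (i, false) = (i, false).
    rewrite [LHS]surjective_pairing; congr (_, _); first exact: ord_eq.
    apply/negbTE; apply: contra evw => wneg.
    rewrite (_ : [set _ | _] = [set i]) ?cards1 //.
    by apply/setP=> j; rewrite !inE (ord_eq j i) eqxx entryE.
  case: b; last exact: w0.
  by have /eqP := oppw (i, false); rewrite w0.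
split; first by apply/forallP=> x; rewrite !perm1.
rewrite (_ : [set _ | _] = set0) ?cards0 //.
by apply/setP=> i; rewrite !inE entryE perm1.
Qed.

Lemma Dpoly_le1 (R : comNzRingType) (n : nat) (s t q : R) :
  (n <= 1)%N -> Dpoly n s t q = 1.
Proof.
move=> le_n1; rewrite /Dpoly Dgroup_le1 // big_set1.
have no_lt (p : 'I_n * 'I_n) : (p.1 < p.2)%N = false.
  by case: n le_n1 p => [|[|//]] _ [[[|i] hi] [[|j] hj]].
rewrite /edesD /odesD /desD_indices ltnNge le_n1 /= /invD.
by rewrite !(eq_card0 (A := mem [set _ | _])) ?mul1r ?expr0 // => p;
  rewrite !inE no_lt.
Qed.

(* Main.v *)
Require Import Defs.
From mathcomp Require Import all_boot all_order all_fingroup all_algebra.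
From mathcomp Require Import zify ring.

(** Why the identity holds.  Let [x_i] be [t] for [i] odd and [s] for [i] even,
    so that [w] has weight the product of [x_i] over its descents [i] (with
    [x_1 = t] also for the descent at [-1]) times [q] to its inversions.

    For [1 <= k <= n] consider the [w] in D_n whose last [k] letters are
    positive and decreasing.  Let [T_k] be their sum when only the descents at
    positions [< n - k] count, and [F_k] ([decposD]) their sum when the descent
    at position [n - k] counts too.  That position is a descent exactly when
    the last [k + 1] letters are positive and decreasing, and it contributes
    [x_(n-k)] instead of [1]; hence
      [F_k = T_k + (x_(n-k) - 1) F_(k+1)]   ([decposD_rec]).
    For [n - k = 1] the position [-1] starts to count along with [1], but it is
    no descent: all letters but the first are positive, hence by parity the
    first one is positive too.
    Since [F_1] is the sum over D_n^+ and [F_n = T_n], unrolling gives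
      [F_1 = sum_k T_k prod_(1 <= j < k) (x_(n-j) - 1)]   ([decposD_expand]),
    and the factors alternate between [s - 1] and [t - 1]; separating odd and
    even [k] yields the two sums of the theorem.

    It remains to see that [T_k] is [q^C(k,2) [n choose k]_q D_(n-k)]
    ([sum_decpos]).  Such a [w] is a pair of a [k]-set [S] of absolute values,
    listed decreasingly at the end, and a signed arrangement [u] of the other
    values, which standardizes to an element of D_(n-k).  The decreasing block
    contains C(k,2) inversions.  A letter [a] of [u] and a positive letter [b]
    of the block contribute [1] for [a > b] or for [- a > b], i.e. for
    [|a| > b]: the cross inversions depend on [S] only, and summing [q] to
    their number over all [S] gives the Gaussian binomial ([sum_crossinv]).

    Signed permutations are handled as words, i.e. lists of integers, because
    splitting a word and relabelling its letters are then list operations. *)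

Set Implicit Arguments.
Unset Strict Implicit.
Unset Printing Implicit Defensive.

Import Order.TTheory GRing.Theory Num.Theory.
Local Open Scope ring_scope.

(** * Signed words and their statistics *)

Fixpoint signings (p : seq nat) : seq (seq int) :=
  if p is a :: p' then
    [seq c :: l | c <- [:: a%:Z; - a%:Z], l <- signings p']
  else [:: [::]].

(** Only membership ([mem_words]) and duplicate-freeness matter below; [undup]
    gives the latter even when [0] occurs in [A] and has two equal signings. *)
Definition words (A : seq nat) : seq (seq int) :=
  undup (flatten [seq signings p | p <- permutations A]).

Lemma mem_signings p l : (l \in signings p) = (map absz l == p).
Proof.
elim: p l => [|a p IHp] [|c l]; rewrite ?inE //.
  by apply/allpairsP => -[[? ?] []].
rewrite eqseq_cons -IHp.
apply/allpairsP/andP => [[[d m] /= [dP mP [-> ->]]]|[/eqP <- lP]].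
  by split=> //; move: dP; rewrite !inE => /orP[] /eqP ->; rewrite ?abszN.
exists (c, l); split=> //=; rewrite !inE; lia.
Qed.

Lemma mem_words A l : (l \in words A) = perm_eq (map absz l) A.
Proof.
rewrite mem_undup; apply/flatten_mapP/idP => [[p]|Al].
  by rewrite mem_permutations mem_signings => pA /eqP ->.
by exists (map absz l); rewrite ?mem_permutations // mem_signings.
Qed.

Lemma uniq_words A : uniq (words A). Proof. exact: undup_uniq. Qed.

Fixpoint invw (l : seq int) : nat :=
  if l is a :: l' then
    (count (fun b => (b < a)%R) l' + count (fun b => (b < - a)%R) l' + invw l')%N
  else 0%N.

Definition evenw (l : seq int) : bool := ~~ odd (count (fun a : int => a < 0) l).

Section Weight.
Variables (R : comNzRingType) (s t : R).

Definition xvar (i : nat) : R := if odd i then t else s.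

(** The weight of the descents at positions [< m].  Positions are 1-based as in
    the definition of the descents, whereas list indices are 0-based.  The first
    factor is the descent at [-1]: it has the weight [t] of an odd one and
    enters together with the position [1], so that [m <= 1] means no descent. *)
Definition desw (m : nat) (l : seq int) : R :=
  (if (1 < m)%N && (l`_1 < - l`_0) then t else 1) *
  \prod_(1 <= i < m) (if l`_i < l`_i.-1 then xvar i else 1).

(** The descents at positions [< m] only see the first [m] letters. *)
Lemma desw_cat m u v : size u = m -> desw m (u ++ v) = desw m u.
Proof.
move=> um; rewrite /desw; congr (_ * _).
  by case: (ltnP 1 m) => //= m1; rewrite !nth_cat um m1 ltnW.
rewrite !big_nat; apply: eq_bigr => i /andP[_ im].
by rewrite !nth_cat um im (leq_ltn_trans (leq_pred i) im).
Qed.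

End Weight.

(** * Standardization *)

Section OddIncreasing.

Variables (phi : int -> int).
Hypothesis phi0 : phi 0 = 0.
Hypothesis phi_mono : {mono phi : x y / x < y}.
Hypothesis phiN : forall x, phi (- x) = - phi x.

Lemma nth_map_phi l i : (map phi l)`_i = phi l`_i.
Proof.
case: (ltnP i (size l)) => il; first by rewrite (nth_map 0).
by rewrite !nth_default ?size_map ?phi0.
Qed.

Lemma invw_map l : invw (map phi l) = invw l.
Proof.
elim: l => //= a l ->; rewrite !count_map; congr (_ + _ + _)%N.
  by apply: eq_count => b /=; rewrite phi_mono.
by apply: eq_count => b /=; rewrite -phiN phi_mono.
Qed.

Lemma evenw_map l : evenw (map phi l) = evenw l.
Proof.
rewrite /evenw count_map; congr (~~ odd _).
by apply: eq_count => b /=; rewrite -{1}phi0 phi_mono.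
Qed.

Lemma desw_map (R : comNzRingType) (s t : R) m l :
  desw s t m (map phi l) = desw s t m l.
Proof.
rewrite /desw !nth_map_phi -phiN phi_mono; congr (_ * _).
by apply: eq_bigr => i _; rewrite !nth_map_phi phi_mono.
Qed.

End OddIncreasing.

(** A relabelling of absolute values acts on signed letters by its odd
    extension to the integers. *)
Definition odd_ext (f : nat -> nat) (x : int) : int :=
  if x < 0 then - (f `|x|%N)%:Z else (f `|x|%N)%:Z.

Lemma words_map f A : f 0%N = 0%N -> injective f ->
  perm_eq (words (map f A)) (map (map (odd_ext f)) (words A)).
Proof.
move=> f0 finj.
have absE x : `|odd_ext f x|%N = f `|x|%N.
  by rewrite /odd_ext; case: ifP; rewrite ?abszN.
have extinj : injective (odd_ext f).
  move=> x y xy; have fxy : `|x|%N = `|y|%N by apply: finj; rewrite -!absE xy.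
  move: xy; rewrite /odd_ext fxy.
  have : f `|y|%N = 0%N -> `|y|%N = 0%N by rewrite -{1}f0 => /finj.
  by case: ifP; case: ifP; lia.
apply: uniq_perm; rewrite ?map_inj_uniq ?uniq_words //; first exact: inj_map.
move=> l; rewrite mem_words; apply/idP/mapP => [lA|[u]]; last first.
  rewrite mem_words => uA ->; rewrite -map_comp (eq_map absE).
  by rewrite [map _ _](map_comp f absz) perm_map.
have [u lE] : exists u, l = map (odd_ext f) u.
  (* A letter comes from a preimage of its absolute value, with the same sign. *)
  have {lA}: {subset map absz l <= map f A} by move=> x; rewrite (perm_mem lA).
  elim: l => [|x l IHl] lA; first by exists [::].
  have [|u ->] := IHl; first by move=> y yl; apply: lA; rewrite inE yl orbT.
  have /mapP[a _ xa] : `|x|%N \in map f A by apply: lA; rewrite inE eqxx.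
  exists ((if x < 0 then - a%:Z else a%:Z) :: u); congr (_ :: _).
  rewrite /odd_ext; have : a = 0%N -> f a = 0%N by move=> ->.
  by case x0: (x < 0) => a0; [case a1: (- a%:Z < 0) | case a1: (a%:Z < 0)];
    rewrite ?abszN /=; lia.
exists u => //; rewrite mem_words; apply: (perm_map_inj finj).
by rewrite -map_comp -(eq_map absE) (map_comp absz) -lE.
Qed.

(** The relabelling is made strictly increasing on all of [nat], not only on
    [0 .. size A], so that its odd extension is monotone without side
    conditions; [f 0 = 0] makes the comparison of a letter with its opposite
    invariant as well. *)
Lemma exists_increasing A : path ltn 0 A ->
  exists2 f, f 0%N = 0%N /\ {homo f : i j / (i < j)%N} &
    map f (iota 1 (size A)) = A.
Proof.
move=> sA; exists (fun i => nth (i + last 0 A)%N (0%N :: A) i); last first.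
  apply: (@eq_from_nth _ 0%N); first by rewrite size_map size_iota.
  rewrite size_map size_iota => i iA; rewrite (nth_map 0%N) ?size_iota //.
  by rewrite nth_iota // add1n /=; apply: set_nth_default.
(* Past the end of [0 :: A], the default [i + last 0 A] keeps [f] increasing. *)
split=> //; apply: homo_ltn; first exact: ltn_trans.
move=> i; cbv beta; case: (ltngtP i (size A)) => iA.
- rewrite (set_nth_default 0%N); last exact: ltnW.
  rewrite [X in (_ < X)%N](set_nth_default 0%N) //=.
  by move/(pathP 0%N): sA; apply.
- by rewrite !nth_default //=; lia.
- rewrite [X in (_ < X)%N]nth_default /= ?iA //.
  rewrite (set_nth_default 0%N) // -[size A]/(size (0%N :: A)).-1 nth_last /=.
  lia.
Qed.

Definition wordD (R : comNzRingType) (s t q : R) (n : nat) : R :=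
  \sum_(l <- words (iota 1 n) | evenw l) desw s t n l * q ^+ invw l.

(** All the statistics compare letters with each other and with opposites of
    letters, so an increasing relabelling of absolute values preserves them. *)
Lemma wordD_standardize (R : comNzRingType) (s t q : R) A : path ltn 0 A ->
  \sum_(u <- words A | evenw u) desw s t (size A) u * q ^+ invw u =
  wordD s t q (size A).
Proof.
case/exists_increasing=> f [f0 fmono] fA.
have fltn : {mono f : i j / (i < j)%N} 
  by move=> i j; case: (ltngtP i j) => [/fmono|/fmono|->]; lia.
have phi0 : odd_ext f 0 = 0 by rewrite /odd_ext /= f0.
have phiN x : odd_ext f (- x) = - odd_ext f x.
  rewrite /odd_ext abszN oppr_lt0; case: (ltrgt0P x) => [x0|x0|->].
  - by [].
  - by rewrite opprK.
  - by rewrite /= f0.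
have phi_mono : {mono odd_ext f : x y / x < y}.
  move=> x y; have := fltn `|x|%N `|y|%N; have := fltn `|y|%N `|x|%N.
  have := fltn 0%N `|x|%N; have := fltn 0%N `|y|%N; rewrite /odd_ext f0.
  by case: ifP; case: ifP; lia.
rewrite -{1}fA (perm_big _ (words_map _ f0 _)) => [|i j]; last first.
  by move=> ij; case: (ltngtP i j) => // /fmono; rewrite ij ltnn.
rewrite big_map /wordD; apply: eq_big => [l | l _].
  exact: evenw_map.
by rewrite desw_map // invw_map.
Qed.

(** * Splitting off a decreasing positive suffix *)

(** The [k]-subsets of a list of length [n], as the masks selecting them. *)
Fixpoint bitseqs (n k : nat) : seq bitseq :=
  match n, k with
  | 0, 0 => [:: [::]]
  | 0, _.+1 => [::]
  | n'.+1, 0 => [seq false :: b | b <- bitseqs n' 0]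
  | n'.+1, k'.+1 =>
      [seq true :: b | b <- bitseqs n' k'] ++
      [seq false :: b | b <- bitseqs n' k'.+1]
  end.

Lemma mem_bitseqs n k b :
  (b \in bitseqs n k) = (size b == n) && (count id b == k).
Proof.
have consK c : injective (cons c : bitseq -> bitseq) by move=> ? ? [].
have consN c c' (b' : bitseq) r :
    c != c' -> (c :: b' \in map (cons c') r) = false.
  by move=> cc'; apply/mapP => -[? _ [cE]]; rewrite cE eqxx in cc'.
elim: n k b => [|n IHn] [|k] [|[] b]; rewrite ?inE ?mem_cat //=;
  rewrite ?mem_map ?consN ?IHn //= ?orbF //.
- by apply/mapP => -[].
- by case: eqP.
- by apply/norP; split; apply/mapP => -[].
Qed.

Lemma uniq_bitseqs n k : uniq (bitseqs n k).
Proof.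
have consK c : injective (cons c : bitseq -> bitseq) by move=> ? ? [].
elim: n k => [|n IHn] [|k] //=; rewrite ?cat_uniq !map_inj_uniq ?IHn //= andbT.
by apply/hasPn => _ /mapP[b _ ->]; apply/mapP => -[].
Qed.

Lemma perm_mask_negb b (A : seq nat) : size b = size A ->
  perm_eq (mask (map negb b) A ++ mask b A) A.
Proof.
elim: A b => [|a A IHA] [|[] b] //= [bA]; last by rewrite perm_cons IHA.
by rewrite perm_catC /= perm_cons perm_catC IHA.
Qed.

Lemma mask_inj (A : seq nat) b b' : uniq A ->
  size b = size A -> size b' = size A -> mask b A = mask b' A -> b = b'.
Proof.
elim: A b b' => [|a A IHA] [|c b] [|c' b'] //= /andP[aA uA] [bA] [b'A].
have notin r : mask r A <> a :: mask r A by move/(congr1 size) => /=; lia.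
case: c c' => [] [] //=.
- by case=> /IHA ->.
- by move=> aE; case/negP: aA; apply: (@mem_mask _ _ b'); rewrite -aE inE eqxx.
- by move=> aE; case/negP: aA; apply: (@mem_mask _ _ b); rewrite aE inE eqxx.
- by move/IHA => ->.
Qed.

(** Appending [0] makes positivity part of the decrease. *)
Definition decpos (d : seq int) : bool := sorted >%R (rcons d 0).

Lemma decpos_rev S : decpos (map Posz (rev S)) = path ltn 0 S.
Proof.
by rewrite /decpos -[0]/(Posz 0) -map_rcons -rev_cons sorted_map rev_sorted.
Qed.

Lemma decposE d : decpos d -> d = map Posz (rev (rev (map absz d))).
Proof.
rewrite /decpos -[rcons d 0]revK rev_rcons rev_sorted revK /=.
move/(order_path_min lt_trans)/allP => d_gt0.
rewrite -map_comp -{1}[d]map_id; apply/eq_in_map => x xd /=.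
by rewrite gez0_abs // ltW // d_gt0 ?mem_rev.
Qed.

(** The suffix is determined by the set of its absolute values, here the letters
    of [A] that the mask [b] selects; the other letters form the prefix. *)
Lemma words_decpos A k : path ltn 0 A -> (k <= size A)%N ->
  perm_eq [seq l <- words A | decpos (drop (size A - k) l)]
    [seq u ++ map Posz (rev (mask b A))
       | b <- bitseqs (size A) k, u <- words (mask (map negb b) A)].
Proof.
move=> A0 kA; set m := (size A - k)%N.
have uA : uniq A by apply: sorted_uniq ltn_trans ltnn _ (path_sorted A0).
have size_negb b : b \in bitseqs (size A) k -> size (mask (map negb b) A) = m.
  rewrite mem_bitseqs => /andP[/eqP bA /eqP bk].
  rewrite size_mask ?size_map // count_map /m -bA -{1}bk.
  by rewrite -(count_predC id b) addKn.
have size_words b u : b \in bitseqs (size A) k ->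
    u \in words (mask (map negb b) A) -> size u = m.
  by move=> bk; rewrite mem_words => /perm_size; rewrite size_map size_negb.
apply: uniq_perm; first exact: filter_uniq (uniq_words A).
  apply: allpairs_uniq_dep => [|b _|]; rewrite ?uniq_bitseqs ?uniq_words //.
  move=> _ _ /allpairsPdep[b [u [bk bu ->]]] /allpairsPdep[b' [u' [bk' bu' ->]]] /=.
  have uu' : size u = size u' by rewrite (size_words b) // (size_words b').
  move/eqP; rewrite eqseq_cat // => /andP[/eqP -> /eqP].
  have Posz_inj : injective Posz by move=> ? ? [].
  move/(inj_map Posz_inj)/(can_inj revK) => bb'.
  move: bk bk'; rewrite !mem_bitseqs => /andP[/eqP bA _] /andP[/eqP bA' _].
  by rewrite (mask_inj uA bA bA' bb').
move=> l; rewrite mem_filter mem_words.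
apply/andP/allpairsPdep => [[ld lA]|[b [u [bk bu ->]]]]; last first.
  rewrite drop_size_cat ?(size_words b) // decpos_rev; split.
    by have := @sorted_mask _ _ ltn_trans (true :: b) (0%N :: A); apply.
  move: bk bu; rewrite mem_bitseqs mem_words => /andP[/eqP bA _] bu.
  rewrite map_cat -map_comp map_id.
  rewrite -(permPr (perm_mask_negb bA)); apply: perm_cat => //.
  by rewrite perm_rev.
pose S := map absz (drop m l); pose b := [seq x \in S | x <- A].
have lE : map absz (take m l) ++ S = map absz l.
  by rewrite -map_cat cat_take_drop.
have bA : size b = size A by rewrite size_map.
have S0 : path ltn 0 (rev S) by rewrite -decpos_rev -decposE.
have SA : {subset S <= A}.
  by move=> x xS; rewrite -(perm_mem lA) -lE mem_cat xS orbT.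
have bS : mask b A = rev S.
  apply: (irr_sorted_eq ltn_trans ltnn _ (path_sorted S0)).
    exact: sorted_mask ltn_trans _ _ (path_sorted A0).
  move=> x; rewrite -filter_mask mem_filter mem_rev.
  by case xS: (_ \in S) => /=; rewrite ?SA.
have bk : b \in bitseqs (size A) k.
  rewrite mem_bitseqs bA eqxx -(size_mask bA) bS size_rev size_map size_drop.
  by rewrite -(size_map absz) (perm_size lA) subKn ?eqxx.
exists b, (take m l); split=> //; last by rewrite bS -decposE // cat_take_drop.
rewrite mem_words -(perm_cat2r S) lE (permPl lA) perm_sym.
by rewrite -(permPr (perm_mask_negb bA)) perm_cat2l bS perm_sym perm_rev.
Qed.

(** * The Gaussian binomial coefficient and the cross inversions *)

Lemma qbinom_small n k : (n < k)%N -> qbinom n k = 0.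
Proof. by rewrite /qbinom ltnNge => /negPf ->. Qed.

Lemma qfact_neq0 n : qfact n != 0.
Proof. by rewrite monic_neq0 ?monic_qfact. Qed.

Lemma qbinom_n0 n : qbinom n 0 = 1.
Proof.
apply: (mulIf (qfact_neq0 n)); rewrite mul1r.
by have := qbinom_fact (leq0n n); rewrite qfact0 mul1r subn0.
Qed.

(** Multiply by [[k+1]! [n-k]!] and use [[n+1] = [n-k] + q^(n-k) [k+1]]. *)
Lemma qbinomS n k :
  qbinom n.+1 k.+1 = 'X^(n - k) * qbinom n k + qbinom n k.+1.
Proof.
have [lt_nk|le_kn] := ltnP n k.
  by rewrite !qbinom_small ?mulr0 ?addr0 // ltnW.
have nz : qfact k.+1 * qfact (n - k) != 0 by rewrite mulf_neq0 ?qfact_neq0.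
apply: (mulIf nz); have := @qbinom_fact n.+1 k.+1 le_kn.
rewrite subSS => ->.
have numS : \sum_(0 <= j < n.+1) 'X^j =
    \sum_(0 <= j < n - k) 'X^j + 'X^(n - k) * \sum_(0 <= j < k.+1) 'X^j
    :> {poly int}.
  by rewrite -qnumD addnS subnK.
rewrite qfactS numS mulrDr mulrDl addrC; congr (_ + _).
  by rewrite -{1}(qbinom_fact le_kn) [qfact k.+1]qfactS; ring.
have [lt_kn|le_nk] := ltnP k n; last first.
  by rewrite qbinom_small // mul0r (eqP le_nk) big_geq // mulr0.
rewrite -{1}(qbinom_fact lt_kn) -(subnSK lt_kn).
by rewrite [qfact (_ - _).+1]qfactS; ring.
Qed.

Lemma qbinom_at_n0 (R : comNzRingType) n (q : R) : qbinom_at n 0 q = 1.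
Proof. by rewrite /qbinom_at qbinom_n0 rmorph1 hornerC. Qed.

Lemma qbinom_at_small (R : comNzRingType) n k (q : R) :
  (n < k)%N -> qbinom_at n k q = 0.
Proof. by move=> nk; rewrite /qbinom_at qbinom_small // rmorph0 horner0. Qed.

Lemma qbinom_atS (R : comNzRingType) n k (q : R) :
  qbinom_at n.+1 k.+1 q = q ^+ (n - k) * qbinom_at n k q + qbinom_at n k.+1 q.
Proof.
by rewrite /qbinom_at qbinomS rmorphD rmorphM /= map_polyXn !hornerE.
Qed.

(** The inversions between a letter of absolute value in [A] and a later
    positive letter in [S]; see [invw_cat_pos]. *)
Definition crossinv (A S : seq nat) : nat :=
  (\sum_(a <- A) count (fun b => (b < a)%N) S)%N.

Lemma perm_crossinv A A' S : perm_eq A A' -> crossinv A S = crossinv A' S.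
Proof. exact: perm_big. Qed.

(** The q-Pascal recurrence, by cases on the least element of [A]: if it is
    selected, every unselected element is larger than it; otherwise it is
    larger than no selected element. *)
Lemma sum_crossinv (R : comNzRingType) (q : R) A k : sorted ltn A ->
  \sum_(b <- bitseqs (size A) k) q ^+ crossinv (mask (map negb b) A) (mask b A)
  = qbinom_at (size A) k q.
Proof.
elim: A k => [|a A IHA] [|k] sA /=.
- by rewrite big_seq1 /crossinv big_nil qbinom_at_n0.
- by rewrite big_nil qbinom_at_small.
all: have aA : all (ltn a) A by apply: order_path_min ltn_trans _.
all: have a0 b : count (fun c => (c < a)%N) (mask b A) = 0%N.
1,3: by apply/eqP; rewrite -leqn0 leqNgt -has_count; apply/hasPn => c /mem_mask;
     move/(allP aA) => /=; rewrite -leqNgt => /ltnW.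
all: have sA' := path_sorted sA.
- rewrite big_map qbinom_at_n0 -(qbinom_at_n0 (size A) q) -IHA //.
  by apply: eq_bigr => b _; rewrite /= /crossinv big_cons a0.
rewrite big_cat !big_map qbinom_atS -!IHA //; congr (_ + _); last first.
  by apply: eq_bigr => b _; rewrite /= /crossinv big_cons a0.
rewrite mulr_sumr !big_seq; apply: eq_bigr => b.
rewrite mem_bitseqs => /andP[/eqP bA /eqP bk] /=.
rewrite -exprD; congr (_ ^+ _).
rewrite {1}/crossinv /= big_split /=; congr (_ + _)%N.
rewrite big_seq (eq_bigr (fun=> 1%N)) => [|c /mem_mask /(allP aA) /= ->] //.
rewrite -big_seq sum1_size size_mask ?size_map // count_map -bA -bk.
by rewrite -(count_predC id b) addKn.
Qed.

Lemma invw_cat u v :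
  invw (u ++ v) = (invw u + invw v + \sum_(a <- u)
    (count (fun b => (b < a)%R) v + count (fun b => (b < - a)%R) v))%N.
Proof.
elim: u => [|a u IHu] /=; first by rewrite big_nil addn0.
by rewrite big_cons IHu !count_cat; ring.
Qed.

(** For [b >= 0], exactly one of [b < a] and [b < - a] holds if [b < |a|], and
    none otherwise. *)
Lemma invw_cat_pos u S :
  invw (u ++ map Posz S) =
  (invw u + invw (map Posz S) + crossinv (map absz u) S)%N.
Proof.
rewrite invw_cat /crossinv big_map; congr (_ + _)%N; apply: eq_bigr => a _.
rewrite !count_map; elim: S => //= b S IHS.
by rewrite addnACA IHS; congr (_ + _)%N; lia.
Qed.

Lemma invw_decpos S : sorted gtn S -> invw (map Posz S) = 'C(size S, 2).
Proof.
elim: S => //= a S IHS aS; rewrite (IHS (path_sorted aS)) binS bin1.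
have /allP Sa : all (gtn a) S.
  by apply: order_path_min aS => x y z /= yx zy; apply: ltn_trans zy yx.
have -> : count (fun b => b < a%:Z) (map Posz S) = size S.
  by rewrite count_map -count_predT; apply: eq_in_count => b /Sa.
have -> : count (fun b => b < - a%:Z) (map Posz S) = 0%N.
  rewrite count_map -(count_pred0 S); apply: eq_in_count => b /Sa /=; lia.
by rewrite addn0 addnC.
Qed.

Lemma evenw_cat_pos u S : evenw (u ++ map Posz S) = evenw u.
Proof.
rewrite /evenw count_cat [X in (_ + X)%N](_ : _ = 0%N) ?addn0 //.
by rewrite count_map; elim: S.
Qed.

(** * The sum over words with a decreasing positive suffix *)

(** The term [T_k].  Positive letters do not change the parity of the number of
    negative ones, so the prefix ranges over even words. *)
Lemma sum_decpos (R : comNzRingType) (s t q : R) n k : (k <= n)%N ->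
  \sum_(l <- words (iota 1 n) | evenw l && decpos (drop (n - k) l))
     desw s t (n - k) l * q ^+ invw l =
  q ^+ 'C(k, 2) * qbinom_at n k q * wordD s t q (n - k).
Proof.
move=> kn; set A := iota 1 n.
have nA : size A = n by rewrite size_iota.
have A0 : path ltn 0 A.
  by rewrite -[path _ _ _]/(sorted ltn (iota 0 n.+1)) iota_ltn_sorted.
under eq_bigl do rewrite andbC.
rewrite -big_filter_cond -nA (perm_big _ (words_decpos A0 _)) ?nA //.
rewrite [LHS]big_mkcond big_allpairs_dep /= -[X in qbinom_at X]nA.
rewrite -sum_crossinv ?(path_sorted A0) //.
rewrite mulr_sumr mulr_suml nA !big_seq; apply: eq_bigr => b.
rewrite mem_bitseqs => /andP[/eqP bA /eqP bk].
have bN_k : size (mask (map negb b) A) = (n - k)%N.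
  rewrite size_mask ?size_map ?bA // count_map -bA -{1}bk.
  by rewrite -(count_predC id b) addKn.
have bS_k : size (mask b A) = k by rewrite size_mask ?nA.
have bN0 : path ltn 0 (mask (map negb b) A).
  by have := @sorted_mask _ _ ltn_trans (true :: map negb b) (0%N :: A); apply.
have bS : sorted gtn (rev (mask b A)).
  by rewrite rev_sorted; apply: sorted_mask (path_sorted A0); apply: ltn_trans.
rewrite -bN_k -wordD_standardize // mulr_sumr -big_mkcond /=.
rewrite big_seq_cond [RHS]big_seq_cond.
apply: eq_big => [u|u /andP[]]; first by rewrite evenw_cat_pos.
rewrite mem_words => uA _.
have um : size u = size (mask (map negb b) A).
  by rewrite -(perm_size uA) size_map.
rewrite desw_cat // invw_cat_pos (perm_crossinv _ uA) invw_decpos //.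
rewrite size_rev bS_k /crossinv.
under [in LHS]eq_bigr do rewrite count_rev.
by rewrite !exprD; ring.
Qed.

(** * The recursion on the length of the suffix *)

(** The sum [F_k]: the position [n - k] is just before the suffix, so counting
    the positions [< n - k + 1] includes it.  For [k = n] it would be [0], and
    no descent is counted. *)
Definition decposD (R : comNzRingType) (s t q : R) (n k : nat) : R :=
  \sum_(l <- words (iota 1 n) | evenw l && decpos (drop (n - k) l))
     desw s t (n - k).+1 l * q ^+ invw l.

Lemma desw_recr (R : comNzRingType) (s t : R) m l : (1 < m)%N ->
  desw s t m.+1 l = desw s t m l * (if l`_m < l`_m.-1 then xvar s t m else 1).
Proof.
move=> m1; rewrite /desw m1 ltnS (ltnW m1) big_nat_recr ?(ltnW m1) //=.
by rewrite mulrA.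
Qed.

(** From [m = 1] to [m = 2] the position [-1] enters together with the
    position [1], and must not be a descent. *)
Lemma desw2 (R : comNzRingType) (s t : R) l : ~~ (l`_1 < - l`_0) ->
  desw s t 2 l = desw s t 1 l * (if l`_1 < l`_0 then xvar s t 1 else 1).
Proof.
by rewrite /desw /= big_nat1 big_geq // => /negPf ->; rewrite !mul1r.
Qed.

Lemma decpos_cons a d : decpos (a :: d) = (d`_0 < a) && decpos d.
Proof. by case: d => [|b d]. Qed.

Lemma decpos_ge0 d : decpos d -> all (fun a => 0 <= a) d.
Proof. by move/decposE->; apply/allP => _ /mapP[x _ ->]. Qed.

(** The first letter is the only one that can be negative, and the number of
    negative letters is even.  Hence [-1] is not a descent when the suffix
    starts at the second letter. *)
Lemma evenw_decpos_behead l : evenw l -> decpos (drop 1 l) -> 0 <= l`_0.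
Proof.
case: l => //= a l; rewrite drop0 /evenw /= => + /decpos_ge0 l_ge0.
rewrite (_ : count _ l = 0%N) ?addn0; first by rewrite leNgt; case: ltP.
apply/eqP; rewrite -leqn0 leqNgt -has_count; apply/hasPn => b.
by move/(allP l_ge0) => /=; rewrite -leNgt.
Qed.

(** Write the weight [x] of the position [n - k] as [1 + (x - 1)] when it is a
    descent, which lengthens the suffix by one letter. *)
Lemma decposD_rec (R : comNzRingType) (s t q : R) n k : (0 < k < n)%N ->
  decposD s t q n k =
  q ^+ 'C(k, 2) * qbinom_at n k q * wordD s t q (n - k) +
  (xvar s t (n - k) - 1) * decposD s t q n k.+1.
Proof.
case/andP=> k0 kn; rewrite -sum_decpos ?(ltnW kn) // /decposD.
rewrite subnSK // mulr_sumr.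
rewrite [X in X + _]big_mkcond [X in _ + X]big_mkcond -big_split.
rewrite [LHS]big_mkcond.
rewrite !big_seq; apply: eq_bigr => l; rewrite mem_words => /perm_size.
rewrite size_map size_iota => ln.
have -> : drop (n - k.+1) l = l`_(n - k).-1 :: drop (n - k) l.
  by rewrite (drop_nth 0) ?subnSK -?subnS // ln; lia.
rewrite decpos_cons nth_drop addn0.
case El: (evenw l) => /=; last by rewrite addr0.
case Pl: (decpos (drop (n - k) l)); rewrite /= ?andbF ?andbT ?addr0 //.
have -> : desw s t (n - k).+1 l = desw s t (n - k) l *
    (if l`_(n - k) < l`_(n - k).-1 then xvar s t (n - k) else 1).
  have [m1|] := ltnP 1 (n - k); first exact: desw_recr.
  rewrite leq_eqVlt => /orP[/eqP m1|]; last by lia.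
  rewrite m1 in Pl *; apply: desw2; rewrite -leNgt.
  apply: (@le_trans _ _ 0); first by rewrite oppr_le0 evenw_decpos_behead.
  move/decpos_ge0/all_nthP: Pl => /(_ 0 0%N); rewrite nth_drop size_drop ln.
  by apply; lia.
by case: ifP => _; ring.
Qed.

(** With an empty prefix there is no position left to count. *)
Lemma decposD_full (R : comNzRingType) (s t q : R) n :
  decposD s t q n n = q ^+ 'C(n, 2) * qbinom_at n n q * wordD s t q (n - n).
Proof.
rewrite -sum_decpos // /decposD subnn; apply: eq_bigr => l _.
by rewrite /desw !big_geq.
Qed.

Lemma decposD_expand (R : comNzRingType) (s t q : R) n : (0 < n)%N ->
  decposD s t q n 1 = \sum_(1 <= k < n.+1)
    q ^+ 'C(k, 2) * qbinom_at n k q * wordD s t q (n - k) *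
    \prod_(1 <= j < k) (xvar s t (n - j) - 1).
Proof.
move=> n0; pose T k := q ^+ 'C(k, 2) * qbinom_at n k q * wordD s t q (n - k).
suff: forall i, (i < n)%N -> decposD s t q n (n - i) =
    \sum_(n - i <= k < n.+1) T k * \prod_(n - i <= j < k) (xvar s t (n - j) - 1).
  by move/(_ n.-1); rewrite (_ : (n - n.-1)%N = 1%N); [apply; lia | lia].
elim=> [_|i IHi i_n].
  by rewrite subn0 big_nat1 [X in _ * X]big_geq // mulr1 decposD_full.
rewrite decposD_rec; last by lia.
rewrite subnSK ?(ltnW i_n) // IHi ?(ltnW i_n) // [RHS]big_ltn; last by lia.
rewrite [X in T _ * X]big_geq // mulr1; congr (_ + _).
rewrite subnSK ?(ltnW i_n) // mulr_sumr; apply: eq_big_nat => k /andP[ik _].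
rewrite [in RHS]big_ltn; last by lia.
rewrite subnSK ?(ltnW i_n) //; ring.
Qed.

(** * The alternating coefficients *)

Lemma prod_xvar_even (R : comNzRingType) (s t : R) n r : (2 * r <= n)%N ->
  \prod_(1 <= j < 2 * r + 1) (xvar s t (n - j) - 1) =
  (s - 1) ^+ r * (t - 1) ^+ r.
Proof.
elim: r => [|r IHr] rn; first by rewrite big_geq // mul1r.
rewrite (_ : (2 * r.+1 + 1)%N = (2 * r + 1).+2); last by lia.
rewrite !big_nat_recr ?IHr /=; [|lia..].
rewrite /xvar (_ : odd (n - (2 * r + 1).+1) = ~~ odd (n - (2 * r + 1))).
  by case: odd; rewrite /= !exprS; ring.
by rewrite -[X in _ = ~~ odd X]subnSK // ?negbK //; lia.
Qed.

Lemma prod_xvar_odd (R : comNzRingType) (s t : R) n r :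
  (0 < r)%N -> (2 * r <= n)%N ->
  \prod_(1 <= j < 2 * r) (xvar s t (n - j) - 1) =
  (s - 1) ^+ (r - 1) * (t - 1) ^+ (r - 1) * ((if odd n then s else t) - 1).
Proof.
case: r => // r _ rn; rewrite (_ : (2 * r.+1)%N = (2 * r + 1).+1); last by lia.
rewrite big_nat_recr /= ?prod_xvar_even; [|lia..].
rewrite subn1 /= /xvar oddB; last by lia.
by rewrite oddD oddM; case: (odd n).
Qed.

Lemma big_odd_even (R : comNzRingType) (f : nat -> R) n :
  \sum_(1 <= k < n.+1) f k =
  \sum_(0 <= r < uphalf n) f (2 * r + 1)%N + \sum_(1 <= r < n./2.+1) f (2 * r)%N.
Proof.
elim: n => [|n IHn]; first by rewrite !big_geq // addr0.
have nE := odd_double_half n.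
rewrite big_nat_recr //= IHn uphalf_half; case: (odd n) nE => /= nE.
  rewrite !add1n [in RHS](big_nat_recr _ 1) //= addrA.
  by congr (_ + f _); lia.
rewrite !add0n [in RHS](big_nat_recr _ 0) //= addrAC.
by congr (_ + f _ + _); lia.
Qed.

(** * From signed permutations to words *)

Definition wordof (n : nat) (w : {perm letter n}) : seq int :=
  mkseq (fun i => entry w i.+1%:Z) n.

Lemma entry_ord n (w : {perm letter n}) (i : 'I_n) :
  entry w i.+1%:Z = letter_val (w (i, false)).
Proof.
rewrite /entry /= insubT ?ltn_ord // => lt_in.
by rewrite (_ : Sub _ _ = i) //; apply: val_inj.
Qed.

Lemma absz_letter_val n (x : letter n) : `|letter_val x|%N = x.1.+1.
Proof. by rewrite /letter_val abszMsign. Qed.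

Lemma letter_val_lt0 n (x : letter n) : (letter_val x < 0) = x.2.
Proof.
by rewrite /letter_val; case: x.2; rewrite ?expr1 ?expr0 ?mulN1r ?mul1r.
Qed.

Lemma letter_val_inj n : injective (@letter_val n).
Proof.
move=> x y xy; apply/eqP; rewrite -pair_eqE /pair_eq /=.
rewrite -!letter_val_lt0 xy eqxx andbT -val_eqE /= -eqSS.
by rewrite -!absz_letter_val xy.
Qed.

Lemma nth_wordof n (w : {perm letter n}) i : (wordof w)`_i = entry w i.+1%:Z.
Proof.
have [lt_in|le_ni] := ltnP i n; first by rewrite nth_mkseq.
by rewrite nth_default ?size_mkseq // /entry /= insubN // -leqNgt.
Qed.

Lemma wordof_enum n (w : {perm letter n}) :
  wordof w = [seq letter_val (w (i, false)) | i <- enum 'I_n].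
Proof.
rewrite /wordof /mkseq -val_enum_ord -map_comp.
by apply: eq_map => i /=; apply: entry_ord.
Qed.

Lemma wordof_inj n : {in Bgroup n &, injective (@wordof n)}.
Proof.
move=> v w; rewrite !inE => /forallP vB /forallP wB vw; apply/permP.
have pos i : v (i, false) = w (i, false).
  by apply: letter_val_inj; rewrite -!entry_ord -!nth_wordof vw.
case=> i []; last exact: pos.
by rewrite -[(i, true)]/(letter_opp (i, false)) (eqP (vB _)) (eqP (wB _)) pos.
Qed.

Lemma wordof_words n (w : {perm letter n}) : w \in Bgroup n ->
  wordof w \in words (iota 1 n).
Proof.
rewrite inE => /forallP wB; rewrite mem_words wordof_enum -map_comp.
rewrite -[1%N]add1n iotaDl -val_enum_ord -map_comp.
(* Opposite letters have opposite images, so the absolute values of the images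
   of the positive letters are distinct. *)
pose h i := (w (i, false)).1.
have hinj : injective h.
  move=> i j; rewrite /h => hij; have winj := @perm_inj _ w.
  case: (boolP ((w (i, false)).2 == (w (j, false)).2)) => [/eqP|] bij.
    suff /winj[] : w (i, false) = w (j, false) by [].
    by rewrite [LHS]surjective_pairing hij bij -surjective_pairing.
  have /winj[] // : w (i, false) = w (j, true).
  rewrite -[(j, true)]/(letter_opp (j, false)) (eqP (wB _)) /letter_opp -hij.
  by rewrite [LHS]surjective_pairing; congr (_, _); move: bij; do 2!case: (_.2).
rewrite (eq_map (g := (fun i : 'I_n => i.+1) \o h)); last first.
  by move=> i /=; rewrite absz_letter_val.
rewrite map_comp; apply: perm_map; apply: uniq_perm.
- by rewrite map_inj_uniq ?enum_uniq.
- exact: enum_uniq.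
move=> i; rewrite mem_enum; apply/mapP.
by exists (invF hinj i); rewrite ?mem_enum ?f_invF.
Qed.

Lemma words_wordof n l : l \in words (iota 1 n) ->
  exists2 w, w \in Bgroup n & wordof w = l.
Proof.
rewrite mem_words => ln; have sl : size l = n.
  by rewrite -(size_map absz) (perm_size ln) size_iota.
have absl (i : 'I_n) : (0 < `|(l`_i)%R| <= n)%N.
  have : `|(l`_i)%R|%N \in map absz l by apply: map_f; rewrite mem_nth ?sl.
  by rewrite (perm_mem ln) mem_iota; lia.
(* [w] sends [+-(i + 1)] to [+- l_i]; [a] is the index of the absolute value. *)
pose a (i : 'I_n) : 'I_n := insubd i (`|(l`_i)%R|.-1)%N.
have aE i : (a i).+1 = `|(l`_i)%R|%N.
  by case/andP: (absl i) => l0 l_n; rewrite /a val_insubd prednK // l_n prednK.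
have ainj : injective a.
  move=> i j aij; apply: val_inj; apply/eqP => /=.
  have ul : uniq (map absz l) by rewrite (perm_uniq ln) iota_uniq.
  rewrite -(nth_uniq 0%N _ _ ul) ?size_map ?sl // !(nth_map 0) ?sl //.
  by rewrite -!aE aij.
pose f (x : letter n) : letter n := (a x.1, x.2 (+) (l`_x.1 < 0)).
have finj : injective f.
  by case=> i b [j c] [/ainj <- /addIb ->].
exists (perm finj).
  rewrite inE; apply/forallP => x; rewrite !permE /f /letter_opp /=.
  by rewrite addNb.
apply: (@eq_from_nth _ 0); first by rewrite size_mkseq.
rewrite size_mkseq => i lt_in; rewrite nth_wordof -[i]/(val (Ordinal lt_in)).
rewrite entry_ord permE /letter_val /f /= aE -[i]/(val (Ordinal lt_in)) /=.
by rewrite -intEsign.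
Qed.

Lemma perm_wordof n :
  perm_eq [seq wordof w | w <- enum (Bgroup n)] (words (iota 1 n)).
Proof.
apply: uniq_perm; rewrite ?uniq_words //.
  rewrite map_inj_in_uniq ?enum_uniq // => v w.
  by rewrite !mem_enum; apply: wordof_inj.
move=> l; apply/mapP/idP => [[w + ->]|/words_wordof[w wB <-]].
  by rewrite mem_enum; apply: wordof_words.
by exists w; rewrite ?mem_enum.
Qed.

Lemma evenw_wordof n (w : {perm letter n}) :
  evenw (wordof w) = ~~ odd #|[set i : 'I_n | entry w i.+1%:Z < 0]|.
Proof.
rewrite /evenw wordof_enum count_map; congr (~~ odd _).
rewrite cardE size_filter -enumT; apply: eq_count => i /=.
by rewrite inE entry_ord.
Qed.

Lemma invw_sum l : invw l =
  (\sum_(i < size l) \sum_(j < size l | (i < j)%N)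
     ((l`_j < l`_i)%R + (l`_j < - l`_i)%R))%N.
Proof.
elim: l => [|a l IHl] /=; first by rewrite big_ord0.
rewrite big_ord_recl /= IHl; congr (_ + _)%N.
  rewrite big_mkcond big_ord_recl /= add0n big_split /=.
  by congr (_ + _)%N; rewrite -sum1_count (big_nth 0) big_mkord big_mkcond;
    apply: eq_bigr => i _; case: ifP.
apply: eq_bigr => i _; rewrite [RHS]big_mkcond big_ord_recl /= add0n.
by rewrite [LHS]big_mkcond.
Qed.

Lemma invw_wordof n (w : {perm letter n}) : invw (wordof w) = invD w.
Proof.
rewrite invw_sum size_mkseq /invD -!sum1_card.
rewrite !(big_mkcond (fun p => p \in _)) /= -big_split /=.
rewrite pair_big_dep big_mkcond.
apply: eq_bigr => -[i j] _; rewrite !inE /= !nth_wordof.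
by case: (i < j)%N => //=; do 2!case: (_ < _)%R.
Qed.

Lemma desw_wordof (R : comNzRingType) (s t : R) n (w : {perm letter n}) :
  w \in Bgroup n -> desw s t n (wordof w) = s ^+ edesD w * t ^+ odesD w.
Proof.
move=> wB.
have expE (I : Type) (x : R) (a : pred I) r :
    x ^+ count a r = \prod_(i <- r) (if a i then x else 1).
  elim: r => [|i r IHr]; rewrite ?big_nil // big_cons /= -IHr.
  by case: (a i); rewrite ?mul1r ?exprS.
rewrite /edesD /odesD !expE -big_split /= /desw /desD_indices.
case: (ltnP 1 n) => n1 /=; last by rewrite big_nil big_geq ?mulr1.
rewrite big_cons big_map; congr (_ * _).
  rewrite !nth_wordof /is_desD /= andbF andbT mul1r.
  by rewrite (entryN (i := 1)).
rewrite /index_iota subn1 big_seq [RHS]big_seq; apply: eq_bigr => i.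
rewrite mem_iota => /andP[i0 _]; rewrite !nth_wordof prednK //.
rewrite /is_desD /xvar /=.
by case: ifP; case: odd; rewrite /= ?mul1r ?mulr1.
Qed.

(** * The two sums as sums over words *)

Lemma DpolyE (R : comNzRingType) (s t q : R) n :
  Dpoly n s t q = wordD s t q n.
Proof.
rewrite /wordD -(perm_big _ (perm_wordof n)) big_map big_enum_cond /=.
apply: eq_big => [w|w]; first by rewrite inE evenw_wordof.
by rewrite inE => /andP[wB _]; rewrite desw_wordof ?invw_wordof.
Qed.

Lemma DplusE (R : comNzRingType) (s t q : R) n : (0 < n)%N ->
  \sum_(w in Dplus n) t ^+ odesD w * s ^+ edesD w * q ^+ invD w =
  decposD s t q n 1.
Proof.
move=> n0; rewrite /decposD subn1 prednK //.
rewrite -(perm_big _ (perm_wordof n)) big_map big_enum_cond /=.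
apply: eq_big => [w|w]; last first.
  rewrite !inE -!andbA => /and3P[wB _ _].
  rewrite desw_wordof ?invw_wordof ?inE //.
  by rewrite [t ^+ _ * _]mulrC.
rewrite !inE evenw_wordof -!andbA; congr [&& _, _ & _].
rewrite (drop_nth 0) ?size_mkseq ?prednK // drop_oversize ?size_mkseq //.
by rewrite decpos_cons andbT nth_wordof prednK.
Qed.

Theorem theorem34 (R : comNzRingType) (s t q : R) (n : nat) (hn : (0 < n)%N) :
  (~~ odd n ->
    \sum_(w in Dplus n) t ^+ odesD w * s ^+ edesD w * q ^+ invD w =
      \sum_(0 <= r < n./2)
        q ^+ 'C(2 * r + 1, 2) * qbinom_at n (2 * r + 1) q *
        Dpoly (n - 2 * r - 1) s t q * (s - 1) ^+ r * (t - 1) ^+ r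
      + \sum_(1 <= r < n./2.+1)
        q ^+ 'C(2 * r, 2) * qbinom_at n (2 * r) q *
        Dpoly (n - 2 * r) s t q * (s - 1) ^+ (r - 1) * (t - 1) ^+ r)
  /\
  (odd n ->
    \sum_(w in Dplus n) t ^+ odesD w * s ^+ edesD w * q ^+ invD w =
      \sum_(0 <= r < n./2.+1)
        q ^+ 'C(2 * r + 1, 2) * qbinom_at n (2 * r + 1) q *
        Dpoly (n - 2 * r - 1) s t q * (s - 1) ^+ r * (t - 1) ^+ r
      + \sum_(1 <= r < n./2.+1)
        q ^+ 'C(2 * r, 2) * qbinom_at n (2 * r) q *
        Dpoly (n - 2 * r) s t q * (s - 1) ^+ r * (t - 1) ^+ (r - 1)).
Proof.
rewrite DplusE // decposD_expand // big_odd_even uphalf_half.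
have nE := odd_double_half n.
split=> n_par; move: nE; rewrite ?n_par ?(negPf n_par) => nE;
  rewrite ?add0n ?add1n; congr (_ + _); apply: eq_big_nat => r /andP[r0 rn].
- rewrite prod_xvar_even; last by lia.
  by rewrite DpolyE subnDA mulrA.
- rewrite prod_xvar_odd ?(negPf n_par) //; last by lia.
  by case: r r0 rn => // r _ _; rewrite DpolyE subn1 /= exprS; ring.
- rewrite prod_xvar_even; last by lia.
  by rewrite DpolyE subnDA mulrA.
- rewrite prod_xvar_odd ?n_par //; last by lia.
  by case: r r0 rn => // r _ _; rewrite DpolyE subn1 /= exprS; ring.
Qed.
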